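(* Let $0<\beta<1$, let $T\ge 2$ be an integer, and let $K_{TC2}$ be the $T\times T$ TC2 kernel matrix with hyperparameter $\beta$. Then the inverse of $K_{TC2}$ admits the decomposition $$K_{TC2}^{-1}=(1-\beta)^{-3}F_T^2\,D_T\,(F_T^2)^\top,$$ where $F_T\in\mathbb{R}^{T\times T}$ is the lower triangular Toeplitz matrix with first column $(1,-1,0,\ldots,0)^\top$, and $$D_T=\begin{bmatrix} D_{1,T} & 0\\ 0& B_T\end{bmatrix},\qquad D_{1,T}=\mathrm{diag}(\beta^{-1},\beta^{-2},\ldots,\beta^{-(T-2)}),$$ $$B_T=(1-\beta)\beta^{-T}\begin{bmatrix}\beta+\beta^2 & 2\beta^2\\ 2\beta^2 & 1-3\beta+4\beta^2\end{bmatrix}$$ (for $T=2$ the block $D_{1,T}$ is empty). Thus $K_{TC2}^{-1}$ is a pentadiagonal matrix, i.e. $[K_{TC2}^{-1}]_{t,s}=0$ whenever $|t-s|>2$.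
   Context: Let $0<\beta<1$. Let $\mathcal{F}$ be the infinite (indexed by $t,s\ge 1$) lower triangular Toeplitz matrix with first column $(1,-1,0,0,\ldots)^\top$ and $\mathcal{D}=\mathrm{diag}(\beta^{-1},\beta^{-2},\ldots,\beta^{-t},\ldots)$. The (infinite) TC2 kernel is $\mathcal{K}_{TC2}=(1-\beta)^3(\mathcal{F}^2\mathcal{D}(\mathcal{F}^\top)^2)^{-1}$, where the inverse is understood as $(\mathcal{F}^{-2})^\top\mathcal{D}^{-1}\mathcal{F}^{-2}$, with $\mathcal{F}^{-1}$ the lower triangular Toeplitz inverse of $\mathcal{F}$, and entries of products of infinite matrices are (convergent) series. The $T\times T$ kernel matrix $K_{TC2}$ is defined by $[K_{TC2}]_{t,s}=[\mathcal{K}_{TC2}]_{t,s}$ for $t,s=1,\ldots,T$. *)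

(* Defs.v *)
From HB Require Import structures.
From mathcomp Require Import all_boot all_order all_algebra.
From mathcomp Require Import all_classical all_reals all_analysis.
Import Order.TTheory GRing.Theory Num.Theory.
Import numFieldNormedType.Exports.

Set Implicit Arguments.
Unset Strict Implicit.
Unset Printing Implicit Defensive.

Local Open Scope classical_set_scope.
Local Open Scope ring_scope.

(* Rows and columns are numbered from 0 throughout: the index t here is the
   index t + 1 of the usual 1-based convention. *)
Definition imx (R : realType) := nat -> nat -> R.

(* An entry is the sum of a series; [limn] is a total function, so the value is
   meaningful only when the series converges. *)
Definition imx_mul (R : realType) (A B : imx R) : imx R :=
  fun i j => limn (fun n => \sum_(0 <= k < n) A i k * B k j).

Definition imx_scale (R : realType) (a : R) (A : imx R) : imx R :=
  fun i j => a * A i j.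

Definition imx_tr (R : realType) (A : imx R) : imx R := fun i j => A j i.

Definition imx_diag (R : realType) (d : nat -> R) : imx R :=
  fun i j => if i == j then d i else 0.

Definition imx1 (R : realType) : imx R := imx_diag (fun=> 1).

(* Lower triangular Toeplitz matrix with first column c. *)
Definition imx_ltoeplitz (R : realType) (c : nat -> R) : imx R :=
  fun i j => if (j <= i)%N then c (i - j)%N else 0.

Definition is_ltoeplitz_inverse (R : realType) (A B : imx R) : Prop :=
  [/\ exists c, B = imx_ltoeplitz c,
      imx_mul A B = imx1 R & imx_mul B A = imx1 R].

(* Arbitrary when A has no lower triangular Toeplitz inverse. *)
Definition ltoeplitz_inv (R : realType) (A : imx R) : imx R :=
  xget (fun _ _ => 0 : R) [set B : nat -> nat -> R | is_ltoeplitz_inverse A B].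

Definition diff_col (R : realType) (i : nat) : R :=
  if i == 0%N then 1 else if i == 1%N then -1 else 0.

Definition Finf (R : realType) : imx R := imx_ltoeplitz (@diff_col R).

Definition Dinf_diag (R : realType) (beta : R) (t : nat) : R := beta ^- t.+1.

(* (1 - beta)^3 (F^2 D (F^T)^2)^-1, read as
   (1 - beta)^3 (F^-2)^T D^-1 F^-2 *)
Definition TC2_kernel (R : realType) (beta : R) : imx R :=
  let Finv := ltoeplitz_inv (Finf R) in
  let Finv2 := imx_mul Finv Finv in
  let Dinv := imx_diag (fun t => (Dinf_diag beta t)^-1) in
  imx_scale ((1 - beta) ^+ 3) (imx_mul (imx_mul (imx_tr Finv2) Dinv) Finv2).

Definition TC2_mx (R : realType) (beta : R) (T : nat) : 'M[R]_T :=
  \matrix_(t < T, s < T) TC2_kernel beta t s.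

Definition F_mx (R : realType) (T : nat) : 'M[R]_T :=
  \matrix_(i < T, j < T)
    (if (j <= i)%N then diff_col R (i - j)%N else 0).

Definition D1_mx (R : realType) (beta : R) (T : nat) : 'M[R]_(T - 2) :=
  diag_mx (\row_(i < T - 2) beta ^- i.+1).

Definition B_mx (R : realType) (beta : R) (T : nat) : 'M[R]_2 :=
  ((1 - beta) * beta ^- T) *:
  (block_mx (beta + beta ^+ 2)%:M (2 * beta ^+ 2)%:M
            (2 * beta ^+ 2)%:M    (1 - 3 * beta + 4 * beta ^+ 2)%:M
     : 'M[R]_(1 + 1)).

(* The cast identifies (T - 2) + 2 with T. *)
Definition D_mx (R : realType) (beta : R) (T : nat) (hT : (2 <= T)%N) :
    'M[R]_T :=
  castmx (subnK hT, subnK hT)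
    (block_mx (D1_mx beta T) 0 0 (B_mx beta T)).

(* Main.v *)
Require Import Defs.
From HB Require Import structures.
From mathcomp Require Import all_boot all_order all_algebra.
From mathcomp Require Import all_classical all_reals all_analysis.
From mathcomp Require Import ring lra zify.
Import Order.TTheory GRing.Theory Num.Theory.
Import numFieldNormedType.Exports.

(* F^-1 is the lower triangular matrix of ones, so L = F^-2 has entries
   i - j + 1 and the kernel entry is (1 - beta)^3 times the sum over k of
   (k - t + 1) (k - s + 1) beta^(k + 1), for indices from 0.  The terms with
   k < T - 2 involve the first T - 2 rows of L and give the block D_{1,T}^-1.
   The rest of the series is quadratic in (T - 1 - t, T - 1 - s), hence a
   quadratic form in rows T - 2 and T - 1 of L, and its matrix is a multiple of
   B_T^-1.  Truncation is multiplicative on lower triangular matrices, so F_T^2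
   inverts the truncation of L and the decomposition follows. *)

Set Implicit Arguments.
Unset Strict Implicit.
Unset Printing Implicit Defensive.

Local Open Scope ring_scope.

(** * Infinite products that reduce to finite sums, and truncation *)

Lemma imx_mul_fin (R : realType) (A B : imx R) (i j n : nat) :
  (forall k, (n <= k)%N -> A i k * B k j = 0) ->
  imx_mul A B i j = \sum_(0 <= k < n) A i k * B k j.
Proof.
move=> AB0; apply: lim_near_cst => //; exists n => // m /= le_nm.
rewrite (big_cat_nat (n := n)) //= [X in _ + X]big_nat [X in _ + X]big1 ?addr0 //.
by move=> k /andP[/AB0].
Qed.

Definition ltri (R : realType) (A : imx R) := forall i k, (i < k)%N -> A i k = 0.

Lemma imx_mul_ltri (R : realType) (A B : imx R) (i j n : nat) :
  ltri A -> (i < n)%N -> imx_mul A B i j = \sum_(0 <= k < n) A i k * B k j.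
Proof.
move=> ltA lt_in; apply: imx_mul_fin => k le_nk.
by rewrite ltA ?mul0r // (leq_trans lt_in).
Qed.

Lemma ltri_toeplitz (R : realType) (c : nat -> R) : ltri (imx_ltoeplitz c).
Proof. by move=> i k lt_ik; rewrite /imx_ltoeplitz leqNgt lt_ik. Qed.

Lemma ltri_Finf (R : realType) : ltri (Finf R).
Proof. exact: ltri_toeplitz. Qed.

Definition ones_ltri (R : realType) : imx R := imx_ltoeplitz (fun=> 1).

Lemma ltri_ones (R : realType) : ltri (ones_ltri R).
Proof. exact: ltri_toeplitz. Qed.

Definition imx_trunc (R : realType) (T : nat) (A : imx R) : 'M[R]_T :=
  \matrix_(i < T, j < T) A i j.

(** Row [i < T] of [A] vanishes beyond column [i], so the series never leaves the truncated range,
    whatever [B] is. *)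
Lemma imx_trunc_mul (R : realType) (T : nat) (A B : imx R) :
  ltri A -> imx_trunc T (imx_mul A B) = imx_trunc T A *m imx_trunc T B.
Proof.
move=> ltA; apply/matrixP => i j.
rewrite !mxE (imx_mul_ltri _ _ ltA (ltn_ord i)) big_mkord.
by apply: eq_bigr => k _; rewrite !mxE.
Qed.

Lemma imx_trunc1 (R : realType) (T : nat) : imx_trunc T (imx1 R) = 1%:M.
Proof. by apply/matrixP => i j; rewrite !mxE /imx1 /imx_diag val_eqE; case: eqP. Qed.

(** * The inverse of [Finf] and its square *)

Lemma FinfE (R : realType) (i j : nat) :
  Finf R i j = (i == j)%:R - (i == j.+1)%:R.
Proof.
rewrite /Finf /imx_ltoeplitz /diff_col.
case: leqP => [le_ji|lt_ij]; last by rewrite !ltn_eqF ?subrr // ltnW.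
have -> : (i == j) = (i - j == 0)%N by lia.
have -> : (i == j.+1) = (i - j == 1)%N by lia.
by case: (i - j)%N => [|[|k]] /=; rewrite ?subr0 ?sub0r.
Qed.

Lemma Finf_mul_toeplitz (R : realType) (c : nat -> R) (i j : nat) :
  imx_mul (Finf R) (imx_ltoeplitz c) i j =
  imx_ltoeplitz c i j - (if i is i'.+1 then imx_ltoeplitz c i' j else 0).
Proof.
rewrite (imx_mul_ltri _ _ (@ltri_Finf R) (ltnSn i)).
rewrite big_nat_recr // FinfE eqxx (ltn_eqF (ltnSn i)) subr0 mul1r addrC.
congr (_ + _); case: i => [|i]; first by rewrite big_geq ?oppr0.
rewrite big_nat_recr // FinfE eqxx (gtn_eqF (ltnSn i)) sub0r mulN1r.
rewrite big_nat big1 /= ?add0r // => k lt_ki.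
by rewrite FinfE eqSS !gtn_eqF ?subrr ?mul0r // (ltn_trans lt_ki).
Qed.

Lemma Finf_inverse (R : realType) : is_ltoeplitz_inverse (Finf R) (ones_ltri R).
Proof.
split; first by exists (fun=> 1).
- apply/funext => i; apply/funext => j; rewrite Finf_mul_toeplitz.
  rewrite /imx1 /imx_diag /imx_ltoeplitz.
  case: i => [|i]; first by rewrite subr0; case: j.
  have -> : (i.+1 == j) = (j <= i.+1)%N && ~~ (j <= i)%N by lia.
  by case: (leqP j i) => [/leqW ->|_] /=; rewrite ?andbF ?subrr ?andbT ?subr0.
- apply/funext => i; apply/funext => j.
  rewrite (imx_mul_ltri _ _ (@ltri_ones R) (ltnSn i)).
  (* Column [j] holds 1 in row [j] and -1 in row [j + 1], so its partial sums vanish except when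
     they stop between the two. *)
  have sumF n : \sum_(0 <= k < n) Finf R k j = (n == j.+1)%:R.
    elim: n => [|n IHn]; first by rewrite big_geq.
    by rewrite big_nat_recr // IHn FinfE eqSS /= addrC subrK.
  transitivity (\sum_(0 <= k < i.+1) Finf R k j).
    rewrite !big_nat; apply: eq_bigr => k; rewrite ltnS => /andP[_ le_ki].
    by rewrite /ones_ltri /imx_ltoeplitz le_ki mul1r.
  by rewrite sumF eqSS /imx1 /imx_diag; case: eqP.
Qed.

(** [xget] returns an unspecified inverse, so uniqueness is needed: column 0 of [F B = 1] forces
    [c 0 = 1] and then [c n.+1 = c n]. *)
Lemma ltoeplitz_inv_Finf (R : realType) : ltoeplitz_inv (Finf R) = ones_ltri R.
Proof.
have [[c Bc] FB _] : is_ltoeplitz_inverse (Finf R) (ltoeplitz_inv (Finf R)).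
  by apply: (xgetPex (T := (nat -> nat -> R : Type))); exists (ones_ltri R);
    exact: Finf_inverse.
rewrite Bc in FB *; congr imx_ltoeplitz; apply/funext => n.
have FB0 i : imx_mul (Finf R) (imx_ltoeplitz c) i 0%N = (i == 0%N)%:R.
  by rewrite FB /imx1 /imx_diag; case: eqP.
elim: n => [|n IHn].
  by have := FB0 0%N; rewrite Finf_mul_toeplitz subr0.
have := FB0 n.+1; rewrite Finf_mul_toeplitz /imx_ltoeplitz /= !subn0 IHn.
by move/eqP; rewrite subr_eq0 => /eqP.
Qed.

(* Truncated subtraction gives the zero entries above the diagonal. *)
Lemma ones_ltri_sqr (R : realType) (i j : nat) :
  imx_mul (ones_ltri R) (ones_ltri R) i j = (i.+1 - j)%:R.
Proof.
rewrite (imx_mul_ltri _ _ (@ltri_ones R) (ltnSn i)).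
transitivity (\sum_(0 <= k < i.+1) ((j <= k)%N%:R : R)).
  rewrite !big_nat; apply: eq_bigr => k; rewrite ltnS => /andP[_ le_ki].
  by rewrite /ones_ltri /imx_ltoeplitz le_ki mul1r; case: leqP.
elim: i.+1 => [|n IHn]; first by rewrite big_geq.
rewrite big_nat_recr //= {}IHn -natrD; congr (_%:R).
by case: leqP; lia.
Qed.

(** * Closed form of the kernel entries *)

Lemma sqr_geometric_bound (R : realType) (beta : R) :
  0 < beta -> beta < 1 ->
  exists C r : R, [/\ `|r| < 1 & forall n, n%:R ^+ 2 * beta ^+ n <= C * r ^+ n].
Proof.
move=> b0 b1.
have sq (x : R) : 0 < x -> x < 1 ->
    exists y, [/\ 0 < y, y < 1 & x = y ^+ 2].
  move=> x0 x1; exists (Num.sqrt x); split; rewrite ?sqrtr_gt0 //.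
    by rewrite -sqrtr1 ltr_sqrt.
  by rewrite sqr_sqrtr // ltW.
(* With q = beta^(1/4), n q^n is bounded by Bernoulli's inequality, and
   n^2 beta^n = (n q^n)^2 (q^2)^n. *)
have [r [r0 r1 ->]] := sq _ b0 b1.
have [q [q0 q1 rq]] := sq _ r0 r1.
pose h := q^-1 - 1.
have h0 : 0 < h by rewrite subr_gt0 invf_gt1.
have nq n : n%:R * q ^+ n <= h^-1.
  suff : n%:R * h <= q ^- n.
    by move=> H; rewrite -ler_pdivlMr ?exprn_gt0 // mulrC ler_pdivlMr.
  have qh : q^-1 = 1 + h by rewrite /h addrC subrK.
  rewrite -exprVn qh; elim: n => [|n IHn]; first by rewrite mul0r expr0.
  have p1 : 1 <= (1 + h) ^+ n by rewrite exprn_ege1 // lerDl ltW.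
  by rewrite exprS -natr1; nra.
exists (h^-1 ^+ 2), r; split; first by rewrite ger0_norm // ltW.
move=> n; have qr : (q ^+ n) ^+ 2 = r ^+ n by rewrite rq -!exprM mulnC.
have -> : n%:R ^+ 2 * (r ^+ 2) ^+ n = (n%:R * q ^+ n) ^+ 2 * r ^+ n.
  by rewrite [in RHS]exprMn qr exprAC; ring.
rewrite ler_wpM2r ?exprn_ge0 ?(ltW r0) // lerXn2r ?nnegrE ?invr_ge0 ?(ltW h0) //.
by rewrite mulr_ge0 // exprn_ge0 // ltW.
Qed.

Definition tail_form (R : realType) (beta u v : R) : R :=
  (1 - beta) ^+ 2 * u * v + beta * (1 - beta) * (u + v) + beta + beta ^+ 2.

(* The tail of the series, summed from [n] on, is
   [beta ^+ n.+1 * tail_form beta (n + 1 - t) (n + 1 - s)]; it stays valid for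
   [t, s = n + 1], where the first term of the tail vanishes. *)
Lemma TC2_kernelE (R : realType) (beta : R) (t s n : nat) :
  0 < beta -> beta < 1 -> (t <= n.+1)%N -> (s <= n.+1)%N ->
  TC2_kernel beta t s =
    (1 - beta) ^+ 3 * (\sum_(0 <= k < n)
      (k.+1 - t)%:R * (k.+1 - s)%:R * beta ^+ k.+1)
    + beta ^+ n.+1 * tail_form beta (n.+1 - t)%:R (n.+1 - s)%:R.
Proof.
move=> b0 b1 le_t le_s.
pose S m : R := \sum_(0 <= k < m) (k.+1 - t)%:R * (k.+1 - s)%:R * beta ^+ k.+1.
pose X m : R := beta ^+ m.+1 * tail_form beta (m.+1 - t)%:R (m.+1 - s)%:R.
rewrite -/(S n) -/(X n).
(* Partial sum plus claimed tail does not depend on [m], because [(1 - beta)^3 u v + beta *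
   tail_form (u + 1) (v + 1) = tail_form u v]. The bounds on [t] and [s] ensure that no subtraction
   truncates here. *)
have SX m : (n <= m)%N -> (1 - beta) ^+ 3 * S m + X m = (1 - beta) ^+ 3 * S n + X n.
  elim: m => [|m IHm]; first by rewrite leqn0 => /eqP->.
  rewrite leq_eqVlt => /predU1P[-> //|]; rewrite ltnS => le_nm; rewrite -IHm //.
  rewrite /S /X big_nat_recr //= !(subSn _ : (m.+2 - _ = _)%N); last 2 first.
  - by lia.
  - by lia.
  rewrite -!natr1 /tail_form [beta ^+ m.+2]exprS.
  move: (\sum_(0 <= i < m) _) (m.+1 - t)%:R (m.+1 - s)%:R (beta ^+ m.+1) => S1 u v B.
  by ring.
have X0 : (X m @[m --> \oo] --> (0 : R))%classic.
  have [C [r [r1 Cr]]] := sqr_geometric_bound b0 b1.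
  have := @cvg_geometric _ (5 * C) _ r1; rewrite -cvg_shiftS => g0.
  apply: (squeeze_cvgr _ (cvg_cst 0) g0); apply: nearW => m /=.
  have ub k : 0 <= ((m.+1 - k)%:R : R) <= m.+1%:R.
    by rewrite ler0n ler_nat leq_subr.
  have /andP[u0 u1] := ub t; have /andP[v0 v1] := ub s.
  have M1 : 1 <= (m.+1%:R : R) by rewrite ler1n.
  have bm : 0 < beta ^+ m.+1 by rewrite exprn_gt0.
  rewrite /X /geometric /= -mulrA.
  move: (Cr m.+1) u0 u1 v0 v1 M1 bm.
  move: (m.+1 - t)%:R (m.+1 - s)%:R (m.+1%:R : R) (beta ^+ m.+1) (C * _).
  move=> u v M B D BD u0 u1 v0 v1 M1 B0.
  have c1 : 0 <= (1 - beta) ^+ 2 <= 1 by apply/andP; split; nra.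
  have c2 : 0 <= beta * (1 - beta) <= 1 by apply/andP; split; nra.
  have c3 : 0 <= beta ^+ 2 <= 1 by apply/andP; split; nra.
  have uv0 : 0 <= u * v by rewrite mulr_ge0.
  have uvM : u * v <= M ^+ 2 by rewrite expr2 ler_pM.
  have MM : M <= M ^+ 2 by rewrite expr2 ler_peMl // (le_trans _ M1).
  move/andP: c1 => [c10 c11]; move/andP: c2 => [c20 c21]; move/andP: c3 => [c30 c31].
  have tailE : tail_form beta u v =
      (1 - beta) ^+ 2 * (u * v) + beta * (1 - beta) * (u + v) + beta + beta ^+ 2.
    by rewrite /tail_form mulrA.
  have T0 : 0 <= tail_form beta u v.
    by rewrite tailE !addr_ge0 ?(mulr_ge0 c10) ?(mulr_ge0 c20) ?addr_ge0 ?(ltW b0).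
  (* All coefficients are at most 1 and [u, v <= M] with [1 <= M], so each of the five terms in
     [u v], [u], [v], [beta], [beta^2] is at most [M^2]. *)
  have T1 : tail_form beta u v <= 5 * M ^+ 2.
    have h1 : (1 - beta) ^+ 2 * (u * v) <= u * v by rewrite ler_piMl.
    have h2 : beta * (1 - beta) * (u + v) <= u + v by rewrite ler_piMl ?addr_ge0.
    by rewrite tailE; lra.
  rewrite mulr_ge0 ?(ltW B0) //=.
  apply: (@le_trans _ _ (B * (5 * M ^+ 2))); first by rewrite ler_wpM2l ?(ltW B0).
  by rewrite mulrCA ler_wpM2l // mulrC.
have Slim : (((1 - beta) ^+ 3 * S m) @[m --> \oo] -->
    ((1 - beta) ^+ 3 * S n + X n))%classic.
  have H : ((((1 - beta) ^+ 3 * S n + X n) - X m) @[m --> \oo] -->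
      (((1 - beta) ^+ 3 * S n + X n) - 0))%classic.
    by apply: cvgB => //; exact: cvg_cst.
  rewrite subr0 in H; apply: cvg_trans H; apply: near_eq_cvg.
  by exists n => // m /= le_nm; rewrite -(SX m) // addrK.
have c0 : (1 - beta) ^+ 3 != 0 by rewrite expf_neq0 // subr_eq0 gt_eqF.
rewrite /TC2_kernel /imx_scale ltoeplitz_inv_Finf.
set L2 := imx_mul (ones_ltri R) _; set A := imx_mul (imx_tr L2) _.
suff -> : imx_mul A L2 t s = ((1 - beta) ^+ 3)^-1 * ((1 - beta) ^+ 3 * S n + X n).
  by rewrite mulVKf.
rewrite /imx_mul; apply: cvg_lim => //.
apply: cvg_trans (cvgM (cvg_cst ((1 - beta) ^+ 3)^-1) Slim).
apply: near_eq_cvg; apply: nearW => m /=.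
rewrite mulKf //; apply: eq_bigr => k _.
(* [imx_tr L2] is upper triangular; it is the diagonal right factor that leaves the single term
   [l = k]. *)
rewrite /A (@imx_mul_fin _ _ _ _ _ k.+1); last first.
  by move=> l lt_kl; rewrite /imx_diag gtn_eqF // mulr0.
rewrite big_nat_recr //= big_nat big1 /=; last first.
  by move=> l lt_lk; rewrite /imx_diag ltn_eqF // mulr0.
rewrite add0r /imx_diag eqxx /imx_tr /L2 !ones_ltri_sqr /Dinf_diag invrK.
by rewrite mulrAC.
Qed.

(** * Block factorization of the truncated kernel *)

Definition B_inv (R : realType) (beta : R) (n : nat) : 'M[R]_2 :=
  (beta ^+ n.+1 / (1 - beta) ^+ 3) *:
  (block_mx (1 - 3 * beta + 4 * beta ^+ 2)%:M (- (2 * beta ^+ 2))%:M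
            (- (2 * beta ^+ 2))%:M            (beta + beta ^+ 2)%:M
     : 'M[R]_(1 + 1)).

(** The unscaled block of [B_mx] has determinant [beta * (1 - beta)^2], and [B_inv] is its adjugate
    over this determinant and the scalar [(1 - beta) * beta^-(n + 2)]. *)
Lemma B_invP (R : realType) (beta : R) (n : nat) :
  0 < beta -> beta < 1 -> B_inv beta n *m B_mx beta (n + 2) = 1%:M.
Proof.
rewrite addn2 => b0 b1; have bN0 : beta != 0 by rewrite gt_eqF.
have cN0 : 1 - beta != 0 by rewrite subr_eq0 gt_eqF.
have bn0 : beta ^+ n != 0 by rewrite expf_neq0.
rewrite /B_inv /B_mx -scalemxAl -scalemxAr scalerA.
rewrite (@mulmx_block _ 1 1 1 1 1 1) -!scalar_mxM -!raddfD /=.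
rewrite (@scale_block_mx _ 1 1 1 1) !scale_scalar_mx.
transitivity (block_mx 1%:M 0 0 1%:M : 'M[R]_(1 + 1)); last first.
  by rewrite -(@scalar_mx_block _ 1 1).
congr (@block_mx _ 1 1 1 1 _ _ _ _).
- by congr _%:M; rewrite !exprS; field; rewrite bn0 bN0.
- rewrite [X in X%:M](_ : _ = 0) ?raddf0 //; ring.
- rewrite [X in X%:M](_ : _ = 0) ?raddf0 //; ring.
- by congr _%:M; rewrite !exprS; field; rewrite bn0 bN0.
Qed.

Lemma TC2_mx_block (R : realType) (beta : R) (n : nat) :
  0 < beta -> beta < 1 ->
  let L : 'M[R]_(n + 2) := imx_trunc (n + 2) (imx_mul (ones_ltri R) (ones_ltri R)) in
  TC2_mx beta (n + 2) = (1 - beta) ^+ 3 *: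
    (L^T *m block_mx (diag_mx (\row_(i < n) beta ^+ i.+1)) 0 0 (B_inv beta n) *m L).
Proof.
move=> b0 b1 L; have cN0 : 1 - beta != 0 by rewrite subr_eq0 gt_eqF.
rewrite -[L]vsubmxK tr_col_mx mul_row_block !mulmx0 addr0 add0r mul_row_col.
rewrite -[dsubmx L](@vsubmxK _ 1 1) (@tr_col_mx _ 1 1) /B_inv -scalemxAr -scalemxAl.
rewrite (@mul_row_block _ _ 1 1 1 1) !mul_mx_scalar (@mul_row_col _ _ 1 1).
apply/matrixP => t s.
rewrite !mxE (TC2_kernelE (n := n)) //; try by have := ltn_ord t; have := ltn_ord s; lia.
rewrite !big_ord1 !mxE !ones_ltri_sqr /= big_mkord !addn0 !addn1.
have st (k : 'I_(n + 2)) : (n.+2 - k = (n.+1 - k).+1)%N by have := ltn_ord k; lia.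
rewrite [in RHS]mulrDr; congr (_ + _).
  congr (_ * _); apply: eq_bigr => k _.
  by rewrite mul_mx_diag !mxE !ones_ltri_sqr /= mulrAC.
(* Rows [n] and [n + 1] of [L] have entries [u], [u + 1] in column [t] and [v], [v + 1] in column
   [s]; the form [B_inv] on these pairs, times [(1 - beta)^3], is [beta^(n + 1) * tail_form u v]. In
   the last column [u = 0]. *)
by rewrite !st -!natr1 /tail_form; field.
Qed.

(** * Band structure *)

Lemma Finf_sqr_eq0 (R : realType) (i j : nat) :
  (i < j)%N || (j.+2 < i)%N -> imx_mul (Finf R) (Finf R) i j = 0.
Proof.
move=> ij; rewrite Finf_mul_toeplitz.
case: i ij => [|i] ij; first by rewrite subr0 ltri_toeplitz //; lia.
rewrite -!/(Finf R) !FinfE.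
have [-> -> -> ->] : [/\ i.+1 == j = false, i.+1 == j.+1 = false, i == j = false
  & i == j.+1 = false] by split; lia.
by rewrite !subrr.
Qed.

(** A nonzero term needs [k] in [[t - 2, t]], [l] in [[s - 2, s]], and either [k = l], whence
    [|t - s| <= 2], or both in the last block. In that case [t >= k] and [s >= l] also lie among the
    last [m <= 2] indices, so the off-diagonal entries of [B] do not widen the band. *)
Lemma block_band_eq0 (R : realType) (m n : nat) (d : 'rV[R]_n) (B : 'M[R]_m)
    (G : 'M[R]_(n + m)) (t s : 'I_(n + m)) :
  (forall i j : 'I_(n + m), (i < j)%N || (j.+2 < i)%N -> G i j = 0) ->
  (m <= 2)%N -> (t.+2 < s)%N || (s.+2 < t)%N ->
  (G *m block_mx (diag_mx d) 0 0 B *m G^T) t s = 0.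
Proof.
move=> G0 le_m2 ts; rewrite mxE big1 // => l _; rewrite !mxE mulr_suml big1 // => k _.
have [tk|] := boolP ((t < k)%N || (k.+2 < t)%N); first by rewrite [G t k]G0 ?mul0r ?mul0r.
have [sl|] := boolP ((s < l)%N || (l.+2 < s)%N); first by rewrite [G s l]G0 ?mulr0.
move: (ltn_ord t) (ltn_ord s).
case: (split_ordP k) => k' ->; case: (split_ordP l) => l' -> /= t_lt s_lt sl tk.
- rewrite block_mxEul mxE; case: eqP => [kl|_]; last by rewrite mulr0n mulr0 mul0r.
  by move: sl tk; rewrite kl; lia.
- by rewrite block_mxEur mxE mulr0 mul0r.
- by rewrite block_mxEdl mxE mulr0 mul0r.
- by move: sl tk; lia.
Qed.

Unset Implicit Arguments.

Theorem proposition6p1 (R : realType) (beta : R) (T : nat)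
    (hbeta0 : 0 < beta) (hbeta1 : beta < 1) (hT : (2 <= T)%N) :
  [/\ TC2_mx beta T \in unitmx,
      invmx (TC2_mx beta T) =
        (1 - beta) ^- 3 *:
          ((F_mx R T *m F_mx R T) *m D_mx beta hT *m (F_mx R T *m F_mx R T)^T)
    & forall t s : 'I_T, (2 < `|t%:Z - s%:Z|)%N ->
        invmx (TC2_mx beta T) t s = 0].
Proof.
(* Generalizing [T - 2] allows [T] to be replaced by [n + 2], so that the cast becomes trivial. *)
rewrite /D_mx /D1_mx; move: (T - 2)%N (subnK hT) => n eT.
case: T / eT {hT}; rewrite castmx_id.
set D := block_mx _ _ _ _.
pose G := imx_trunc (n + 2) (imx_mul (Finf R) (Finf R)).
have GE : F_mx R (n + 2) *m F_mx R (n + 2) = G.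
  by rewrite /G imx_trunc_mul //; exact: ltri_Finf.
rewrite GE; set inv := (_ *: _).
have cN0 : 1 - beta != 0 by rewrite subr_eq0 gt_eqF.
have bN0 : beta != 0 by rewrite gt_eqF.
have KI : TC2_mx beta (n + 2) *m inv = 1%:M.
  have [_ FJ _] := Finf_inverse R.
  rewrite TC2_mx_block // -scalemxAl -scalemxAr scalerA mulfV ?expf_neq0 // scale1r.
  set L := imx_trunc _ _; set E := block_mx _ _ _ _.
  have GL : G *m L = 1%:M.
    have FJn : imx_trunc (n + 2) (Finf R) *m imx_trunc (n + 2) (ones_ltri R) = 1%:M.
      by rewrite -imx_trunc_mul ?FJ ?imx_trunc1 //; exact: ltri_Finf.
    rewrite /G /L !imx_trunc_mul; try exact: ltri_Finf; try exact: ltri_ones.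
    by rewrite mulmxA -(mulmxA (imx_trunc _ (Finf R))) FJn mulmx1.
  have ED : E *m D = 1%:M.
    rewrite /E /D mulmx_block !mulmx0 !mul0mx !addr0 !add0r B_invP //.
    rewrite mulmx_diag (_ : \row__ _ = const_mx 1).
      by rewrite diag_const_mx -scalar_mx_block.
    by apply/rowP => i; rewrite !mxE mulfV // expf_neq0.
  (* [L^T E L G D G^T] collapses from the inside: [L G = 1] follows from [G L = 1] for square
     matrices, then [E D = 1], then [L^T G^T = (G L)^T]. *)
  rewrite !mulmxA -(mulmxA _ L G) (mulmx1C GL) mulmx1 -(mulmxA _ E D) ED mulmx1.
  by rewrite -trmx_mul GL trmx1.
have Ku := (mulmx1_unit KI).1.
have invK : invmx (TC2_mx beta (n + 2)) = inv.
  by rewrite -[LHS]mulmx1 -KI mulmxA mulVmx // mul1mx.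
split=> // t s ts; rewrite invK mxE block_band_eq0 ?mulr0 //.
  by move=> i j ij; rewrite mxE Finf_sqr_eq0.
by lia.
Qed.
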